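(* For all nonnegative integers $n_1, n_2, n_3$ we have $$\binom{2n_1+n_2+2n_3+1}{2n_3}+\binom{n_2+2n_3}{2n_3}=\sum_{n_4=0}^{n_3}\left(\binom{n_1+n_2+n_3+n_4+1}{2n_4}+\binom{n_1+n_2+n_3+n_4}{2n_4}\right)\binom{n_1+n_3-n_4}{2(n_3-n_4)}$$ and $$\binom{2n_1+n_2+2n_3+2}{2n_3}+\binom{n_2+2n_3}{2n_3}=\sum_{n_4=0}^{n_3}\binom{n_1+n_2+n_3+n_4+1}{2n_4}\left(\binom{n_1+n_3-n_4+1}{2(n_3-n_4)}+\binom{n_1+n_3-n_4}{2(n_3-n_4)}\right).$$
   Context: Binomial coefficients are defined, for a nonnegative integer $n$, by $\binom{x}{0}=1$ and $\binom{x}{n}=\frac{x(x-1)\cdots(x-n+1)}{n!}\in\mathbb{Q}[x]$, evaluated at the indicated value of $x$. In particular $\binom{a}{b}=0$ for integers $0\le a<b$. *)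

(* Defs.v *)
From mathcomp Require Import all_boot all_order all_algebra.

Set Implicit Arguments.
Unset Strict Implicit.
Unset Printing Implicit Defensive.

Import GRing.Theory Num.Theory.

(* Binomial coefficients are the values of the polynomials
   x (x - 1) ... (x - b + 1) / b! in Q[x]; at a natural number a this value is
   the library's natural number 'C(a, b), which is 0 when a < b. *)
Lemma bin_prodE (a b : nat) :
  ('C(a, b)%:R = (\prod_(i < b) (a%:R - i%:R)) / b`!%:R :> rat)%R.
Proof.
have fN0 : (b`!%:R != 0 :> rat)%R by rewrite pnatr_eq0 -lt0n fact_gt0.
apply: (canRL (mulfK fN0)); rewrite -natrM bin_ffact.
elim: b {fN0} => [|b IHb]; first by rewrite big_ord0.
rewrite big_ord_recr /= -IHb ffactnSr natrM.
have [le_ba|lt_ab] := leqP b a; first by rewrite natrB.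
by rewrite ffact_small // !mul0r.
Qed.

(* Main.v *)
Require Import Defs.
From mathcomp Require Import all_boot.
From mathcomp Require Import all_algebra zify ring.

(** With z = 4 sinh(u/2)^2, the polynomial sum_k C(m + k, 2k) z^k equals
    cosh((m + 1/2) u) / cosh(u/2), and the sum of two consecutive ones, of
    indices m and m - 1, equals 2 cosh(m u). Both identities are the
    coefficient of z^n3 in the product formula for hyperbolic cosines. The
    product formula itself is proved from the three-term recurrence
    F_(m+2) = (2 + z) F_(m+1) - F_m. *)

Import GRing.Theory Num.Theory.

Section CentralBinomialPoly.
Local Open Scope ring_scope.

(** These are the Morgan-Voyce polynomials. The cut-off at degree [m] is harmless:
    ['C(m + k, 2 * k)] vanishes for [k > m]. *)
Definition central_poly (m : nat) : {poly int} :=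
  \poly_(k < m.+1) ('C(m + k, 2 * k))%:R.

Local Notation F := central_poly.

Lemma coef_central_poly (m k : nat) : (F m)`_k = ('C(m + k, 2 * k))%:R.
Proof. by rewrite coef_poly; case: ltnP => // lt_mk; rewrite bin_small //; lia. Qed.

Lemma central_poly0 : F 0 = 1.
Proof.
apply/polyP => k; rewrite coef_central_poly coef1.
by case: k => [|k] //=; rewrite bin_small //; lia.
Qed.

Lemma central_poly1 : F 1 = 1 + 'X.
Proof.
apply/polyP => k; rewrite coef_central_poly coefD coef1 coefX.
by case: k => [|[|k]] //=; rewrite bin_small //; lia.
Qed.

Lemma central_polySS (m : nat) : F m.+2 = (2 + 'X) * F m.+1 - F m.
Proof.
apply/eqP; rewrite -subr_eq opprK eq_sym; apply/eqP/polyP => k.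
rewrite mulrDl coefD mulr_natl coefMn coefXM coefD !coef_central_poly.
case: k => [|k] /=; first by rewrite !bin0.
(* Pascal's rule applied twice: the second difference of C(N, 2k+2) in N is C(N, 2k). *)
rewrite !addnS !addSn mulnS add2n !binS !natrD; ring.
Qed.

(** 2 cosh A cosh B = cosh(A + B) + cosh(A - B) with A = (a + b + 1)u and B = (a + 1/2)u, divided by
    cosh(u/2). *)
Lemma central_poly_mul1 (a b : nat) :
  (F (a + b).+1 + F (a + b)) * F a = F (2 * a + b).+1 + F b.
Proof.
elim/ltn_ind: a b => -[|[|a]] IH b.
- by rewrite central_poly0 mulr1.
- by rewrite central_poly1 !central_polySS; ring.
(* Both instances keep [a + b] fixed, so the first factor stays the same and only the recurrence in
   [a] is used. *)
have := IH a.+1 (ltnSn _) b.+1; have := IH a (leqnSn _) b.+2.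
rewrite (_ : a + b.+2 = (a + b).+2)%N; last lia.
rewrite (_ : a.+1 + b.+1 = (a + b).+2)%N; last lia.
rewrite (_ : a.+2 + b = (a + b).+2)%N; last lia.
rewrite (_ : 2 * a + b.+2 = (2 * a + b).+2)%N; last lia.
rewrite (_ : 2 * a.+1 + b.+1 = (2 * a + b).+3)%N; last lia.
rewrite (_ : 2 * a.+2 + b = (2 * a + b).+4)%N; last lia.
move=> IH0 IH1; rewrite (central_polySS a) mulrBr mulrCA IH0 IH1.
by rewrite (central_polySS (2 * a + b).+3) (central_polySS b); ring.
Qed.

(** The same product formula with A = (a + b + 3/2)u and B = (a + 1)u. *)
Lemma central_poly_mul2 (a b : nat) :
  F (a + b).+1 * (F a.+1 + F a) = F (2 * a + b).+2 + F b.
Proof.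
elim/ltn_ind: a b => -[|[|a]] IH b.
- by rewrite central_poly0 central_poly1 central_polySS; ring.
- by rewrite !central_polySS central_poly0 central_poly1; ring.
have := IH a.+1 (ltnSn _) b.+1; have := IH a (leqnSn _) b.+2.
rewrite (_ : a + b.+2 = (a + b).+2)%N; last lia.
rewrite (_ : a.+1 + b.+1 = (a + b).+2)%N; last lia.
rewrite (_ : a.+2 + b = (a + b).+2)%N; last lia.
rewrite (_ : 2 * a + b.+2 = (2 * a + b).+2)%N; last lia.
rewrite (_ : 2 * a.+1 + b.+1 = (2 * a + b).+3)%N; last lia.
rewrite (_ : 2 * a.+2 + b = (2 * a + b).+4)%N; last lia.
move=> IH0 IH1.
(* By linearity, sums of consecutive polynomials obey the same recurrence. *)
have -> : F a.+3 + F a.+2 = (2 + 'X) * (F a.+2 + F a.+1) - (F a.+1 + F a).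
  by rewrite (central_polySS a.+1) (central_polySS a); ring.
rewrite mulrBr mulrCA IH0 IH1.
by rewrite (central_polySS (2 * a + b).+4) (central_polySS b); ring.
Qed.

End CentralBinomialPoly.

Theorem theorem1 (n1 n2 n3 : nat) :
  ('C(2 * n1 + n2 + 2 * n3 + 1, 2 * n3) + 'C(n2 + 2 * n3, 2 * n3) =
   \sum_(0 <= n4 < n3.+1)
     ('C(n1 + n2 + n3 + n4 + 1, 2 * n4) + 'C(n1 + n2 + n3 + n4, 2 * n4)) *
     'C(n1 + n3 - n4, 2 * (n3 - n4)))
  /\
  ('C(2 * n1 + n2 + 2 * n3 + 2, 2 * n3) + 'C(n2 + 2 * n3, 2 * n3) =
   \sum_(0 <= n4 < n3.+1)
     'C(n1 + n2 + n3 + n4 + 1, 2 * n4) *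
     ('C(n1 + n3 - n4 + 1, 2 * (n3 - n4)) + 'C(n1 + n3 - n4, 2 * (n3 - n4)))).
Proof.
rewrite !big_mkord; split; apply/eqP; rewrite -(eqr_nat int) natr_sum natrD.
(* In both parts [a = n1] and [b = n2 + n3]; the coefficient of degree [n3] of the product is the
   convolution sum. *)
- rewrite (_ : 2 * n1 + n2 + 2 * n3 + 1 = (2 * n1 + (n2 + n3)).+1 + n3); last lia.
  rewrite (_ : n2 + 2 * n3 = n2 + n3 + n3); last lia.
  rewrite -!coef_central_poly -coefD -central_poly_mul1 coefM.
  apply/eqP/eq_bigr => k _; rewrite coefD !coef_central_poly -natrD -natrM.
  (* The bound [k <= n3] makes the truncated [n1 + (n3 - k)] equal to [n1 + n3 - k]. *)
  have lt_k := ltn_ord k.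
  by congr (_%:R)%R; congr (('C(_, _) + 'C(_, _)) * 'C(_, _)); lia.
- rewrite (_ : 2 * n1 + n2 + 2 * n3 + 2 = (2 * n1 + (n2 + n3)).+2 + n3); last lia.
  rewrite (_ : n2 + 2 * n3 = n2 + n3 + n3); last lia.
  rewrite -!coef_central_poly -coefD -central_poly_mul2 coefM.
  apply/eqP/eq_bigr => k _; rewrite coefD !coef_central_poly -natrD -natrM.
  have lt_k := ltn_ord k.
  by congr (_%:R)%R; congr ('C(_, _) * ('C(_, _) + 'C(_, _))); lia.
Qed.
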